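(* There exists an orbit equivalence coupling between $\mathbb Z^4$ and the Heisenberg group $\mathbb H(\mathbb Z)$ that is $(\mathrm L^p,\mathrm L^p)$-integrable for every $p<1$.
   Context: $\mathbb H(\mathbb Z)$ is the set $\mathbb Z^3$ with the group law $(x,y,z)\cdot(x',y',z')=(x+x',y+y',z+z'+yx')$. An orbit equivalence coupling between finitely generated groups $\Gamma=\langle S_\Gamma\rangle$ and $\Lambda=\langle S_\Lambda\rangle$ ($S_\Gamma,S_\Lambda$ finite symmetric) is a standard probability space $(X,\mu)$ with free (up to null sets) measure-preserving actions of $\Gamma$ and $\Lambda$ such that $\Gamma\cdot x=\Lambda\cdot x$ for almost every $x\in X$. For $y\in\Lambda\cdot x$, $d_{S_\Lambda}(x,y)$ is the minimal word length of $\lambda\in\Lambda$ with $y=\lambda\cdot x$; $d_{S_\Gamma}$ is defined similarly. For $p>0$, the coupling is $(\mathrm L^p,\mathrm L^p)$-integrable if $\int_Xd_{S_\Lambda}(x,\gamma\cdot x)^p\,d\mu(x)<\infty$ for all $\gamma\in\Gamma$ and $\int_Xd_{S_\Gamma}(x,\lambda\cdot x)^p\,d\mu(x)<\infty$ for all $\lambda\in\Lambda$. *)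

(* Defs.v *)
From HB Require Import structures.
From mathcomp Require Import all_boot all_order all_algebra.
From mathcomp Require Import ring.
From mathcomp Require Import all_classical all_reals all_analysis.

Set Implicit Arguments.
Unset Strict Implicit.
Unset Printing Implicit Defensive.

Import Order.TTheory GRing.Theory Num.Theory.

Local Open Scope classical_set_scope.
Local Open Scope ring_scope.

Definition heisenberg : Type := (int * int * int)%type.

HB.instance Definition _ := Choice.copy heisenberg (int * int * int)%type.

Definition heis_mul (g h : heisenberg) : heisenberg :=
  let: (x, y, z) := g in let: (x', y', z') := h in
  (x + x', y + y', z + z' + y * x').

Definition heis_one : heisenberg := (0, 0, 0).

Definition heis_inv (g : heisenberg) : heisenberg :=
  let: (x, y, z) := g in (- x, - y, - z + y * x).

Lemma heis_mulA : associative heis_mul.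
Proof. by move=> [[? ?] ?] [[? ?] ?] [[? ?] ?]; congr (_, _, _); ring. Qed.

Lemma heis_mul1g : left_id heis_one heis_mul.
Proof. by move=> [[? ?] ?]; congr (_, _, _); ring. Qed.

Lemma heis_mulg1 : right_id heis_one heis_mul.
Proof. by move=> [[? ?] ?]; congr (_, _, _); ring. Qed.

Lemma heis_mulVg : left_inverse heis_one heis_inv heis_mul.
Proof. by move=> [[? ?] ?]; congr (_, _, _); ring. Qed.

Lemma heis_mulgV : right_inverse heis_one heis_inv heis_mul.
Proof. by move=> [[? ?] ?]; congr (_, _, _); ring. Qed.

HB.instance Definition _ := isGroup.Build heisenberg
  heis_mulA heis_mul1g heis_mulg1 heis_mulVg heis_mulgV.

(* [to_multiplicative] turns the additive group of 'rV[int]_4 into a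
   [groupType], so that [*%g] on [Z4] is the addition of vectors. *)
Definition Z4 : groupType := Algebra.to_multiplicative 'rV[int]_4.

Definition words (G : groupType) (S : set G) : set (seq G) :=
  [set w : seq G | forall s, s \in w -> S s].

Definition finite_symmetric_generating (G : groupType) (S : set G) : Prop :=
  [/\ finite_set S,
      forall s, S s -> S (s^-1)%g
    & forall g : G, exists2 w, words S w & (\prod_(s <- w) s)%g = g].

(* Both lengths below are infima of sets of natural numbers embedded in \bar R,
   hence minima when these sets are nonempty; for a generating [S],
   [orbit_dist] is +oo exactly when [y] is not in the orbit of [x]. *)
Definition word_length (R : realType) (G : groupType) (S : set G) (g : G) :
    \bar R :=
  ereal_inf [set (size w)%:R%:E | w in
    [set w : seq G | words S w /\ (\prod_(s <- w) s)%g = g]].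

Definition orbit_dist (R : realType) (G : groupType) (S : set G) (X : Type)
    (a : G -> X -> X) (x y : X) : \bar R :=
  ereal_inf [set word_length R S g | g in [set g : G | y = a g x]].

Definition act_orbit (G : groupType) (X : Type) (a : G -> X -> X) (x : X) :
    set X :=
  [set a g x | g in [set: G]].

Definition is_group_action (G : groupType) (X : Type) (a : G -> X -> X) :
    Prop :=
  (forall x, a 1%g x = x) /\ (forall g h x, a (g * h)%g x = a g (a h x)).

Definition borel_set (T : topologicalType) : set (set T) :=
  <<s [set U : set T | open U] >>.

(* A Hausdorff, second countable, complete pseudometric space is a Polish
   space: [ball] is a pseudometric inducing the topology, and the Hausdorff
   condition makes it separate points. *)
Definition standard_borel (R : realType) (d : measure_display)
    (X : measurableType d) : Prop :=
  exists (P : completePseudoMetricType R) (f : X -> P),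
    [/\ hausdorff_space P, @second_countable P, bijective f
      & forall A : set X, measurable A <-> borel_set (f @` A)].

Record free_pmp_action (R : realType) (d : measure_display)
    (X : measurableType d) (mu : probability X R) (G : groupType)
    (a : G -> X -> X) : Prop := FreePmpAction {
  fpa_action : is_group_action a;
  fpa_measurable : forall g, measurable_fun [set: X] (a g);
  fpa_preserving :
    forall g (A : set X), measurable A -> mu (a g @^-1` A) = mu A;
  fpa_free : {ae mu, forall x, forall g, a g x = x -> g = 1%g} }.

Record oe_coupling (R : realType) (d : measure_display)
    (X : measurableType d) (mu : probability X R) (G H : groupType)
    (a : G -> X -> X) (b : H -> X -> X) : Prop := OeCoupling {
  oe_standard : standard_borel R X;
  oe_left : free_pmp_action mu a;
  oe_right : free_pmp_action mu b;
  oe_orbits : {ae mu, forall x, act_orbit a x = act_orbit b x} }.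

(* The integrand is a nonnegative function which is +oo at most on a null set
   when [a] and [b] have almost everywhere the same orbits. *)
Definition orbit_dist_Lp (R : realType) (d : measure_display)
    (X : measurableType d) (mu : probability X R) (G H : groupType)
    (SH : set H) (a : G -> X -> X) (b : H -> X -> X) (p : R) : Prop :=
  forall g : G, (\int[mu]_x (orbit_dist R SH b x (a g x) `^ p) < +oo)%E.

Definition Lp_Lp_integrable (R : realType) (d : measure_display)
    (X : measurableType d) (mu : probability X R) (G H : groupType)
    (SG : set G) (SH : set H) (a : G -> X -> X) (b : H -> X -> X) (p : R) :
    Prop :=
  orbit_dist_Lp mu SH a b p /\ orbit_dist_Lp mu SG b a p.

(* Main.v *)
From HB Require Import structures.
Require Import Defs.
From mathcomp Require Import all_boot all_order all_algebra.
From mathcomp Require Import zify ring lra.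
From mathcomp Require Import all_classical all_reals all_analysis.
From mathcomp Require Import measurable_realfun.

(* Both groups are self-similar: with [delta] the doubling of Z^4, respectively
   the dilation (x, y, z) |-> (2x, 2y, 4z) of H(Z), the image of [delta] has
   index 16, so after choosing coset representatives every word of n digits in
   base 16 names an element of the group. The 16^n elements so obtained form a
   Folner tile with boundary of order 8^n and word diameter of order 2^n.

   On [0, 1[ with Lebesgue measure, call two points tail equivalent when their
   base-16 expansions agree from some place on. For tail-equivalent x and y,
   the element c(y) c(x)^-1, where c is read on sufficiently many leading
   digits, is a cocycle; it is injective in y, and, because the tiles are
   Folner, for almost every x it takes every value. Sending x to the y with
   cocycle value g is thus a free action whose orbits are the tail classes, for
   both groups at once. Moving x by g alters more than n digits with probability
   O(2^-n), and altering n digits moves x by O(2^n) for the other group, so the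
   p-th moment of the distance is bounded by the sum of the 2^(np) 2^-n, which
   is finite for p < 1. *)

Set Implicit Arguments.
Unset Strict Implicit.
Unset Printing Implicit Defensive.

Import Order.TTheory GRing.Theory Num.Theory.

Local Open Scope classical_set_scope.
Local Open Scope nat_scope.

(** * Self-similar Folner tilings *)

Section words.
Variables (G : groupType) (S : set G).
Implicit Types (g h : G) (m n : nat).

Definition length_le g n : Prop :=
  exists w : seq G, [/\ words S w, (\prod_(s <- w) s)%g = g & size w <= n].

Lemma length_leW g m n : m <= n -> length_le g m -> length_le g n.
Proof.
by move=> mn [w [Sw wg sw]]; exists w; split => //; exact: leq_trans mn.
Qed.

Lemma length_le1 n : length_le 1%g n.
Proof. by exists [::]; split => //; rewrite big_nil. Qed.

Lemma length_leM g h m n :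
  length_le g m -> length_le h n -> length_le (g * h)%g (m + n).
Proof.
move=> [v [Sv <- sv]] [w [Sw <- sw]]; exists (v ++ w); split.
- by move=> s; rewrite mem_cat => /orP[/Sv|/Sw].
- by rewrite big_cat.
- by rewrite size_cat leq_add.
Qed.

Lemma length_leX g m k : length_le g m -> length_le (g ^+ k)%g (k * m).
Proof.
move=> gm; elim: k => [|k IHk]; first by rewrite expg0 mul0n; exact: length_le1.
by rewrite expgS mulSn; exact: length_leM.
Qed.

Hypothesis Ssym : forall s, S s -> S s^-1%g.

Lemma length_leV g n : length_le g n -> length_le g^-1%g n.
Proof.
move=> [w [Sw wg sw]]; apply: length_leW sw _.
elim: w g Sw wg => [|s w IHw] g Sw <-.
  by rewrite big_nil invg1; exact: length_le1.
rewrite big_cons invgM -[size _]addn1; apply: length_leM.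
  by apply: IHw => // t tw; apply: Sw; rewrite inE tw orbT.
exists [:: s^-1%g]; split=> [t||//]; last by rewrite big_seq1.
by rewrite inE => /eqP->; apply: Ssym; apply: Sw; rewrite mem_head.
Qed.

End words.

Section tiles.
Variables (G : groupType) (c : nat -> nat -> G).

Definition tile n : seq G := [seq c n i | i <- iota 0 (16 ^ n)].

Definition exits n (g : G) : nat :=
  count (fun k => (g * k)%g \notin tile n) (tile n).

Lemma size_tile n : size (tile n) = 16 ^ n.
Proof. by rewrite size_map size_iota. Qed.

Lemma tileP n x :
  reflect (exists2 i, i < 16 ^ n & x = c n i) (x \in tile n).
Proof.
apply: (iffP mapP) => -[i]; first by rewrite mem_iota => ? ->; exists i.
by move=> ? ->; exists i => //; rewrite mem_iota.
Qed.

Lemma exits_le n g : exits n g <= 16 ^ n.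
Proof. by rewrite -(size_tile n) count_size. Qed.

Lemma exits1 n : exits n 1%g = 0.
Proof.
apply/eqP; rewrite -leqn0 leqNgt -has_count -all_predC; apply/allP => x xT /=.
by rewrite mul1g xT.
Qed.

Hypothesis tile_uniq : forall n, uniq (tile n).

(** A tile element lost by [g * h] is either lost by [h], or kept by [h] and then lost by [g]; left
    translation by [h] injects the second kind into the elements lost by [g]. *)
Lemma exitsM n g h : exits n (g * h)%g <= exits n g + exits n h.
Proof.
pose P k := ((h * k)%g \in tile n) && ((g * (h * k))%g \notin tile n).
have Pg : count P (tile n) <= exits n g.
  rewrite -size_filter -(size_map (fun k => h * k)%g) -[exits n g]size_filter.
  apply: uniq_leq_size.
    by rewrite map_inj_uniq; [exact: filter_uniq|exact: mulgI].
  by move=> _ /mapP[k + ->]; rewrite !mem_filter => /andP[/andP[-> ->]].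
rewrite addnC (leq_trans _ (leq_add (leqnn (exits n h)) Pg))//.
set b := leqRHS; have {b}-> : b = _ := esym (count_predUI _ _ _).
apply: leq_trans (leq_addr _ _); apply: sub_count => k /=.
by rewrite /P mulgA; case: ((h * k)%g \in _) => //= ->.
Qed.

(** Left translation by [g] injects the elements that [g] keeps in the tile into those that [g^-1]
    keeps; kept and lost elements add up to [16 ^ n]. *)
Lemma exitsV n g : exits n g^-1%g <= exits n g.
Proof.
have E h : exits n h + count (fun k => (h * k)%g \in tile n) (tile n) = 16 ^ n.
  rewrite -(size_tile n) -(count_predC (fun k => (h * k)%g \in tile n)) addnC.
  by congr addn.
rewrite -(leq_add2r (count (fun k => (g^-1 * k)%g \in tile n) (tile n))).
rewrite E -(E g) leq_add2l -!size_filter -[leqLHS](size_map (fun k => g * k)%g).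
apply: uniq_leq_size.
  by rewrite map_inj_uniq; [exact: filter_uniq|exact: mulgI].
by move=> _ /mapP[k + ->]; rewrite !mem_filter mulKg => /andP[-> ->].
Qed.

Definition exits_bounded (g : G) : Prop :=
  exists C, forall n, exits n g <= C * 8 ^ n.

Lemma exits_bounded1 : exits_bounded 1%g.
Proof. by exists 0 => n; rewrite exits1. Qed.

Lemma exits_boundedM g h :
  exits_bounded g -> exits_bounded h -> exits_bounded (g * h)%g.
Proof.
move=> [C gC] [D hD]; exists (C + D) => n; apply: leq_trans (exitsM n g h) _.
by rewrite mulnDl leq_add.
Qed.

Lemma exits_boundedV g : exits_bounded g -> exits_bounded g^-1%g.
Proof. by move=> [C gC]; exists C => n; apply: leq_trans (exitsV n g) _. Qed.

End tiles.

(* The tile [tile c n] has [16 ^ n] elements, boundary of order [8 ^ n] and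
   diameter of order [2 ^ n]. [tiling_cocycle] says that [c n.+1] extends
   [c n] by right multiplication with an element depending on the last
   base-16 digit only. *)
Record tiling (G : groupType) (c : nat -> nat -> G) : Prop := Tiling {
  tiling_inj : forall n, {in gtn (16 ^ n) &, injective (c n)};
  tiling_cocycle : forall n i j d, d < 16 ->
    (c n.+1 (i * 16 + d)%N / c n.+1 (j * 16 + d)%N = c n i / c n j)%g;
  tiling_exits : forall g, exits_bounded c g;
  tiling_length : forall S, finite_symmetric_generating S ->
    exists C, forall n i, length_le S (c n i) (C * 2 ^ n) }.

(** * Tiles generated by an injective endomorphism and sixteen digits *)

Section selfsimilar.
Variables (G : groupType) (delta : G -> G) (f : nat -> G).
Hypothesis deltaM : {morph delta : g h / (g * h)%g}.
Hypothesis delta_inj : injective delta.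
Hypothesis f_inj : forall d e g h, d < 16 -> e < 16 ->
  (f d * delta g = f e * delta h)%g -> d = e.

(** If d_1 ... d_n are the last [n] base-16 digits of [i], most significant first, this is the
    product of the [iter k delta (f d_(k+1))] for k < n in increasing order. A further digit
    multiplies on the right, so it cancels in the quotients of [tiling_cocycle]. *)
Fixpoint sscoord n (i : nat) : G :=
  if n is n'.+1 then
    (sscoord n' (i %/ 16)%N * iter n' delta (f (i %% 16)%N))%g
  else 1%g.

Let delta1 : delta 1%g = 1%g.
Proof. by apply: (mulgI (delta 1%g)); rewrite -deltaM !mulg1. Qed.

(** [sscoord] splits off the last digit, but left multiplication acts on the first digit and carries
    to the right. The splitting at the first digit follows from the other one by induction. *)
Lemma mem_sstile n x : x \in tile sscoord n.+1 <->
  exists d k, [/\ d < 16, k \in tile sscoord n & x = (f d * delta k)%g].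
Proof.
have memS m y : y \in tile sscoord m.+1 <->
    exists d k,
      [/\ d < 16, k \in tile sscoord m & y = (k * iter m delta (f d))%g].
  split=> [/tileP[i im ->]|[d [_ [d16 /tileP[i im ->] ->]]]].
    exists (i %% 16), (sscoord m (i %/ 16)); split=> //;
      first by rewrite ltn_mod.
    by apply/tileP; exists (i %/ 16) => //; rewrite ltn_divLR// -expnSr.
  apply/tileP; exists (i * 16 + d).
    rewrite expnSr; apply: leq_trans (leq_mul im (leqnn 16)).
    by rewrite mulSn addnC ltn_add2r.
  by rewrite /= divnMDl// divn_small// addn0 modnMDl modn_small.
have T0 : tile sscoord 0 = [:: 1%g] by [].
elim: n x => [|n IHn] x.
  rewrite memS; split=> -[d [k [d16]]]; rewrite T0 inE => /eqP-> ->;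
    exists d, 1%g; split=> //=; rewrite ?inE//= ?mul1g ?delta1 ?mulg1//.
rewrite memS; split=> -[d [k [d16 + ->]]].
  move=> /IHn[e [l [e16 lT ->]]].
  exists e, (l * iter n delta (f d))%g; split=> //.
    by apply/memS; exists d, l.
  by rewrite deltaM mulgA iterS.
move=> /memS[e [l [e16 lT ->]]]; exists e, (f d * delta l)%g; split=> //.
  by apply/IHn; exists d, l.
by rewrite deltaM mulgA iterS.
Qed.

(** The sixteen pieces are disjoint because, by [f_inj], the digits lie in distinct cosets of the
    image of [delta]. *)
Let sstileS n : uniq (tile sscoord n) ->
  let T := [seq (f d * delta k)%g | d <- iota 0 16, k <- tile sscoord n] in
  uniq T /\ perm_eq (tile sscoord n.+1) T.
Proof.
move=> uT T; have uT' : uniq T.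
  apply: allpairs_uniq => //.
  move=> [d k] [e l] /allpairsPdep[d' [k' [d16 _ [-> ->]]]] {d k}.
  move=> /allpairsPdep[e' [l' [e16 _ [-> ->]]]] {e l} /= E.
  rewrite !mem_iota /= add0n in d16 e16.
  have de := f_inj d16 e16 E.
  by move: E; rewrite de => /mulgI/delta_inj ->.
have mT : tile sscoord n.+1 =i T.
  move=> x; apply/idP/idP => [/mem_sstile[d [k [d16 kT ->]]]|].
    by apply/allpairsPdep; exists d, k; rewrite mem_iota.
  move=> /allpairsPdep[d [k [+ kT ->]]]; rewrite mem_iota => d16.
  by apply/mem_sstile; exists d, k.
split => //; apply: uniq_perm => //.
(* A list with the same members and the same size as the repetition-free [T] has no repetition
   either. *)
rewrite (eq_uniq _ mT)// size_tile size_allpairs size_iota size_tile.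
by rewrite expnS.
Qed.

Lemma sstile_uniq n : uniq (tile sscoord n).
Proof.
elim: n => [//|n IHn].
by have [uT /perm_uniq ->] := sstileS IHn.
Qed.

(* [s] is the section of [g] at the digit [d] for the action of [g] on infinite
   words of digits: the group element carried over to the next digit. *)

Lemma exits_section n (g : G) (B : nat -> nat) :
  (forall d, d < 16 -> exists e s,
    [/\ e < 16, (g * f d = f e * delta s)%g & exits sscoord n s <= B d]) ->
  exits sscoord n.+1 g <= \sum_(0 <= d < 16) B d.
Proof.
move=> gB; have [_ /permP Tp] := sstileS (sstile_uniq n).
rewrite [exits _ _ _]Tp count_flatten sumnE big_map big_map /index_iota subn0.
rewrite big_seq [leqRHS]big_seq; apply: leq_sum => d; rewrite mem_iota => d16.
have [e [s [e16 gd sB]]] := gB d d16.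
apply: leq_trans sB; rewrite count_map; apply: sub_count => k /=.
(* [g] sends [f d * delta k] to [f e * delta (s * k)], so it can leave the tile only if [s] moves
   [k] out of the smaller tile. *)
apply: contra => skT; apply/mem_sstile; exists e, (s * k)%g; split=> //.
by rewrite mulgA gd deltaM mulgA.
Qed.

Lemma sscoord_inj n : {in gtn (16 ^ n) &, injective (sscoord n)}.
Proof.
move=> i j; rewrite !inE => ilt jlt cij.
have /uniqP := sstile_uniq n => /(_ 1%g i j).
rewrite !inE size_tile !(nth_map 0) ?size_iota// !nth_iota// !add0n.
exact.
Qed.

Lemma sscoord_cocycle n i j d : d < 16 ->
  (sscoord n.+1 (i * 16 + d)%N / sscoord n.+1 (j * 16 + d)%N =
   sscoord n i / sscoord n j)%g.
Proof.
move=> d16; rewrite /= !divnMDl// !divn_small// !addn0 !modnMDl.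
by rewrite mulgKA.
Qed.

Section length.
Variable S : set G.
Hypothesis Sgen : finite_symmetric_generating S.

Definition linear_growth (g : G) : Prop :=
  exists C, forall n, length_le S (iter n delta g) (C * 2 ^ n).

Let iterM n : {morph iter n delta : g h / (g * h)%g}.
Proof. by elim: n => // n IHn g h /=; rewrite IHn deltaM. Qed.

Lemma linear_growthM g h :
  linear_growth g -> linear_growth h -> linear_growth (g * h)%g.
Proof.
move=> [C gC] [D hD]; exists (C + D) => n; rewrite iterM mulnDl.
exact: length_leM.
Qed.

Lemma linear_growthV g : linear_growth g -> linear_growth g^-1%g.
Proof.
have [_ Ssym _] := Sgen; move=> [C gC]; exists C => n.
rewrite (_ : iter n delta g^-1%g = (iter n delta g)^-1%g).
  exact: length_leV.
apply: (mulgI (iter n delta g)); rewrite -iterM !mulgV.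
by elim: n {gC} => //= n ->.
Qed.

Lemma linear_growth_sq g : delta g = (g ^+ 2)%g -> linear_growth g.
Proof.
move=> dg; have [_ _ /(_ g)[w Sw wg]] := Sgen.
exists (size w) => n; rewrite (_ : iter n delta g = g ^+ (2 ^ n)%N)%g.
  by rewrite mulnC; apply: length_leX; exists w.
have dX k : (delta (g ^+ k) = (g ^+ k) ^+ 2)%g.
  elim: k => [|k IHk]; first by rewrite !expg0 delta1 expg1n.
  by rewrite {1}expgS deltaM dg IHk -!expgnA -expgnDr mulSn.
by elim: n => [|n IHn]; rewrite ?expg1//= IHn dX -expgnA -expnSr.
Qed.

(** The digit of rank n contributes a word of length at most [C * 2 ^ n], and these lengths form a
    geometric sum. The constant [C] adds up those of the sixteen digits. *)
Lemma sscoord_length : (forall d, d < 16 -> linear_growth (f d)) ->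
  exists C, forall n i, length_le S (sscoord n i) (C * 2 ^ n).
Proof.
move=> fl; have [C fC] : exists C, forall d n, d < 16 ->
    length_le S (iter n delta (f d)) (C * 2 ^ n).
  elim: {-2}16 (leqnn 16) => [|m IHm] m16; first by exists 0.
  have [C fC] := IHm (ltnW m16); have [D fD] := fl m m16.
  exists (C + D) => d n; rewrite ltnS leq_eqVlt => /predU1P[->|dm].
    by apply: length_leW (fD n); rewrite leq_mul2r leq_addl orbT.
  by apply: length_leW (fC d n dm); rewrite leq_mul2r leq_addr orbT.
exists C; elim=> [|n IHn] i /=; first exact: length_le1.
rewrite expnS mul2n -addnn mulnDr; apply: length_leM => //.
by apply: fC; rewrite ltn_mod.
Qed.

End length.

Lemma sscoord_tiling :
  (forall g, exits_bounded sscoord g) ->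
  (forall S, finite_symmetric_generating S ->
    forall d, d < 16 -> linear_growth S (f d)) ->
  tiling sscoord.
Proof.
move=> ex lg; split=> //; [exact: sscoord_inj|exact: sscoord_cocycle|].
by move=> S gS; apply: sscoord_length => //; exact: lg.
Qed.

End selfsimilar.

Lemma int_powers (G : groupType) (P : G -> Prop) (phi : int -> G) :
  (forall g h, P g -> P h -> P (g * h)%g) -> (forall g, P g -> P g^-1%g) ->
  {morph phi : m n / (m + n)%R >-> (m * n)%g} -> P (phi 1%R) ->
  forall m, P (phi m).
Proof.
move=> PM PV phiD P1.
have phi0 : phi 0%R = 1%g.
  by apply: (mulgI (phi 0%R)); rewrite -phiD addr0 mulg1.
have phiN m : phi (- m)%R = (phi m)^-1%g.
  by apply: (mulgI (phi m)); rewrite -phiD subrr mulgV.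
elim=> [|n Pn|n Pn]; first by rewrite phi0 -(mulgV (phi 1%R)); exact/PM/PV.
  by rewrite -addn1 PoszD phiD; exact: PM.
by rewrite -addn1 PoszD opprD phiD; apply: PM => //; rewrite phiN; exact: PV.
Qed.

(** * The tiling of Z^4 by cubes of side 2^n *)

Section Z4_tiling.

Let delta (v : Z4) : Z4 := (v * v)%g.

Let digit (d i : nat) : nat := (d %/ 2 ^ i) %% 2.

Let f (d : nat) : Z4 := (\row_(i < 4) (digit d i)%:Z)%R.

Let e (i : 'I_4) : Z4 := delta_mx 0%R i.

Let mulE (u v : Z4) : (u * v)%g = (u + v)%R :> 'rV[int]_4. Proof. by []. Qed.

Let oneE : (1%g : Z4) = 0%R :> 'rV[int]_4. Proof. by []. Qed.

Let deltaM : {morph delta : u v / (u * v)%g}.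
Proof. by move=> u v; rewrite /delta !mulE addrACA. Qed.

Let delta_inj : injective delta.
Proof.
move=> u v /rowP uv; apply/rowP => i; move: (uv i).
by rewrite /delta !mulE !mxE; set a := u _ _; set b := v _ _; lia.
Qed.

Let digitP d d' : d < 16 -> d' < 16 ->
  (forall i : 'I_4, digit d i = digit d' i) -> d = d'.
Proof.
have E : all (fun a => all (fun b =>
    all (fun i => digit a i == digit b i) (iota 0 4) ==> (a == b)) (iota 0 16))
  (iota 0 16) by [].
move=> d16 d'16 dd'; have /allP/(_ d) := E; rewrite mem_iota => /(_ d16).
move=> /allP/(_ d'); rewrite mem_iota => /(_ d'16)/implyP H; apply/eqP/H.
by apply/allP => i; rewrite mem_iota => i4; rewrite (dd' (Ordinal i4)).
Qed.

Let f_inj d d' g h : d < 16 -> d' < 16 ->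
  (f d * delta g = f d' * delta h)%g -> d = d'.
Proof.
move=> d16 d'16 /rowP E; apply: digitP => // i; move: (E i).
rewrite /delta !mulE !mxE.
have: digit d i < 2 by rewrite ltn_mod.
have: digit d' i < 2 by rewrite ltn_mod.
by lia.
Qed.

Let digit_flip d (i : 'I_4) : d < 16 ->
  let d' := if digit d i == 0 then d + 2 ^ i else d - 2 ^ i in
  d' < 16 /\ forall j : 'I_4,
    digit d' j = if j == i then 1 - digit d i else digit d j.
Proof.
have E : all (fun d => all (fun i =>
    let d' := if digit d i == 0 then d + 2 ^ i else d - 2 ^ i in
    (d' < 16) && all (fun j =>
      digit d' j == if j == i then 1 - digit d i else digit d j) (iota 0 4))
  (iota 0 4)) (iota 0 16) by [].
move=> d16 d'; have /allP/(_ d) := E; rewrite mem_iota => /(_ d16).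
move=> /allP/(_ (nat_of_ord i)); rewrite mem_iota ltn_ord => /(_ isT).
move=> /andP[-> /allP dj]; split=> // j; apply/eqP; have := dj j.
by rewrite mem_iota ltn_ord => /(_ isT).
Qed.

Let c := sscoord delta f.

(** Adding [e i] is binary addition with carry on bit [i]: a bit 0 becomes 1 with trivial section, a
    bit 1 becomes 0 and carries [e i]. Eight of the sixteen digits carry, whence the factor 8. *)
Let exits_e (i : 'I_4) n : exits c n (e i) <= 8 ^ n.
Proof.
elim: n => [|n IHn]; first exact: exits_le.
pose B d := if digit d i == 0 then 0 else exits c n (e i).
apply: leq_trans (_ : \sum_(0 <= d < 16) B d <= _).
  apply: exits_section => // d d16; have [d'16 d'E] := digit_flip i d16.
  have : digit d i < 2 by rewrite ltn_mod.
  rewrite /B; case: ifP d'16 d'E => [/eqP di0|di0] d'16 d'E di2.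
    exists (d + 2 ^ i), 1%g; split=> //; last by rewrite exits1.
    apply/rowP => j; rewrite /delta oneE !mulE !mxE d'E /=.
    case: (eqVneq j i) => [->|_]; last by rewrite add0r !addr0.
    by rewrite di0 !addr0.
  exists (d - 2 ^ i), (e i); split=> //.
  apply/rowP => j; rewrite /delta !mulE !mxE d'E /=.
  case: (eqVneq j i) => [->|_]; last by rewrite add0r !addr0.
  by rewrite (_ : digit d i = 1)//; move: di0 di2; case: digit => [|[|]].
rewrite expnS; apply: leq_trans (leq_mul (leqnn 8) IHn); rewrite /B.
by case: i {IHn B} => [[|[|[|[|//]]]] i4]; rewrite unlock /=; lia.
Qed.

Let Z4_ind (P : Z4 -> Prop) :
  (forall g h, P g -> P h -> P (g * h)%g) -> (forall g, P g -> P g^-1%g) ->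
  P 1%g -> (forall i, P (e i)) -> forall g, P g.
Proof.
move=> PM PV P1 Pe g; rewrite [g]row_sum_delta.
apply: (big_ind P) => // i _.
apply: (int_powers (phi := fun m => (m *: delta_mx 0 i)%R : Z4)) => //.
  by move=> m n; rewrite mulE scalerDl.
by rewrite scale1r; exact: Pe.
Qed.

Lemma Z4_tiling : exists c : nat -> nat -> Z4, tiling c.
Proof.
exists c; apply: sscoord_tiling => //.
  apply: Z4_ind.
  - by move=> g h; apply: exits_boundedM; exact: sstile_uniq.
  - by move=> g; apply: exits_boundedV; exact: sstile_uniq.
  - exact: exits_bounded1.
  - by move=> i; exists 1 => n; rewrite mul1n; exact: exits_e.
by move=> S gS d _; exact: linear_growth_sq.
Qed.

End Z4_tiling.

(** * The tiling of the Heisenberg group *)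

Section heisenberg_tiling.

Let delta (g : heisenberg) : heisenberg :=
  let: (x, y, z) := g in (x *+ 2, y *+ 2, z *+ 4)%R.

Let f (d : nat) : heisenberg :=
  (Posz (d %% 2), Posz (d %/ 2 %% 2), Posz (d %/ 4)).

Let X : heisenberg := (1, 0, 0)%R.
Let Y : heisenberg := (0, 1, 0)%R.
Let Z : heisenberg := (0, 0, 1)%R.

Let mulE (g h : heisenberg) : (g * h)%g = heis_mul g h. Proof. by []. Qed.

Let deltaM : {morph delta : g h / (g * h)%g}.
Proof.
by move=> [[x y] z] [[x' y'] z']; rewrite !mulE /=; congr (_, _, _); ring.
Qed.

Let delta_inj : injective delta.
Proof.
by move=> [[x y] z] [[x' y'] z'] [hx hy hz]; congr (_, _, _); lia.
Qed.

Let f_inj d d' g h : d < 16 -> d' < 16 ->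
  (f d * delta g = f d' * delta h)%g -> d = d'.
Proof.
move: g h => [[x y] z] [[x' y'] z'] d16 d'16.
rewrite !mulE => -[]; rewrite -/(_ + _)%R => hx hy.
(* The third coordinates contain the twist [(d %/ 2 %% 2) * 2x]; once the second digits and [x]
   agree it cancels, and the base-4 digits can be compared modulo 4. *)
have -> : d %/ 2 %% 2 = d' %/ 2 %% 2 by lia.
have -> : x = x' by lia.
lia.
Qed.

Let c := sscoord delta f.

(* [e d] is the digit, and [s d] the section, of [g] at the digit [d]. *)
Let exits_table n (g : heisenberg) (e : nat -> nat) (s : nat -> heisenberg)
  (B : nat -> nat) :
  all (fun d => (e d < 16) && ((g * f d)%g == (f (e d) * delta (s d))%g))
    (iota 0 16) ->
  (forall d, exits c n (s d) <= B d) ->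
  exits c n.+1 g <= \sum_(0 <= d < 16) B d.
Proof.
move=> /allP es sB; apply: exits_section => // d d16.
have := es d; rewrite mem_iota => /(_ d16)/andP[e16 /eqP E].
by exists (e d), (s d).
Qed.

Let tile_uniq n : uniq (tile c n). Proof. exact: sstile_uniq. Qed.

(** [Z] adds 1 to the base-4 digit [d %/ 4]; only the value 3, taken by four of the sixteen digits,
    carries, and the carry is again [Z]. *)
Let exits_Z n : exits c n Z <= 4 ^ n.
Proof.
elim: n => [|n IHn]; first exact: exits_le.
pose s d := if d %/ 4 == 3 then Z else 1%g.
pose B d := if d %/ 4 == 3 then exits c n Z else 0.
apply: leq_trans (_ : \sum_(0 <= d < 16) B d <= _).
  apply: (@exits_table _ _ (fun d => if d %/ 4 == 3 then d - 12 else d + 4) s).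
    by [].
  by move=> d; rewrite /s /B; case: ifP => // _; rewrite exits1.
by rewrite expnS unlock /= /B /=; lia.
Qed.

(* The summand [4 * 4 ^ n] absorbs the central carries counted by [exits_Z]. *)
Let exits_X n : exits c n X + 4 * 4 ^ n <= 5 * 8 ^ n.
Proof.
elim: n => [|n IHn]; first by have := exits_le c 0 X; lia.
(* When the x-bit overflows, [delta X] stands to the right of the y-bit. If that bit is 1, the twist
   adds 2 to the third coordinate, so the base-4 digit is lowered by 2, with a borrow [Z^-1] when it
   is below 2. *)
pose e d := if ~~ odd d then d.+1
  else if ~~ odd (d %/ 2) then d.-1 else if 2 <= d %/ 4 then d - 9 else d + 7.
pose s d := if ~~ odd d then 1%g
  else if odd (d %/ 2) && (d %/ 4 < 2) then (X * Z^-1)%g else X.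
pose B d := if ~~ odd d then 0 else exits c n X + exits c n Z.
suff : exits c n.+1 X <= \sum_(0 <= d < 16) B d.
  by have := exits_Z n; rewrite !expnS unlock /= /B /=; lia.
apply: (@exits_table _ _ e s) => // d; rewrite /s /B; case: ifP => _.
  by rewrite exits1.
case: ifP => _; last exact: leq_addr.
by apply: leq_trans (exitsM _ _ _ _) _; rewrite ?leq_add2l ?exitsV.
Qed.

Let exits_Y n : exits c n Y + 4 * 4 ^ n <= 5 * 8 ^ n.
Proof.
elim: n => [|n IHn]; first by have := exits_le c 0 Y; lia.
pose carry d := 3 < d %/ 4 + d %% 2.
pose e d :=
  (if odd (d %/ 2) then d - 2 else d + 2) + 4 * (d %% 2) - 16 * carry d.
pose s d := ((if odd (d %/ 2) then Y else 1) * (if carry d then Z else 1))%g.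
(* Charging a carry [Z] to all sixteen digits adds [16 * 4 ^ n] to [8 * exits c n Y]. Since 8 * 4 =
   16 + 16, the summand [4 * 4 ^ n] is just enough; the constant 5 is 1 + 4, from n = 0. *)
pose B d := (if odd (d %/ 2) then exits c n Y else 0) + exits c n Z.
suff : exits c n.+1 Y <= \sum_(0 <= d < 16) B d.
  by have := exits_Z n; rewrite !expnS unlock /= /B /=; lia.
apply: (@exits_table _ _ e s) => // d.
apply: leq_trans (exitsM _ _ _ _) _ => //; rewrite /B leq_add//.
  by case: ifP => // _; rewrite exits1.
by case: ifP => // _; rewrite exits1.
Qed.

(** The centre needs no assumption of its own, [Z] being a commutator of [X] and [Y]. This is how
    [Z] gets linear growth although [delta] maps it to its fourth power. *)
Let heisenberg_ind (P : heisenberg -> Prop) :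
  (forall g h, P g -> P h -> P (g * h)%g) -> (forall g, P g -> P g^-1%g) ->
  P X -> P Y -> forall g, P g.
Proof.
move=> PM PV PX PY [[x y] z].
have PZ : P Z.
  rewrite (_ : Z = Y^-1 * X^-1 * (Y * X))%g//.
  by apply: (PM); apply: (PM) => //; exact: (PV).
pose a : heisenberg := (x, 0, 0)%R; pose b : heisenberg := (0, y, 0)%R.
pose k : heisenberg := (0, 0, z)%R.
rewrite (_ : (x, y, z) = (a * b * k)%g); last first.
  rewrite !mulE /=; congr (_, _, _); ring.
apply: (PM); first apply: (PM).
- apply: (int_powers (phi := fun m => (m, 0, 0)%R : heisenberg)) => // m n.
  by rewrite mulE /=; congr (_, _, _); ring.
- apply: (int_powers (phi := fun m => (0, m, 0)%R : heisenberg)) => // m n.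
  by rewrite mulE /=; congr (_, _, _); ring.
- apply: (int_powers (phi := fun m => (0, 0, m)%R : heisenberg)) => // m n.
  by rewrite mulE /=; congr (_, _, _); ring.
Qed.

Lemma heisenberg_tiling : exists c : nat -> nat -> heisenberg, tiling c.
Proof.
exists c; apply: sscoord_tiling => //.
  apply: heisenberg_ind.
  - by move=> g h; exact: exits_boundedM.
  - by move=> g; exact: exits_boundedV.
  - by exists 5 => n; apply: leq_trans (exits_X n); exact: leq_addr.
  - by exists 5 => n; apply: leq_trans (exits_Y n); exact: leq_addr.
move=> S gS d _; move: (f d); apply: heisenberg_ind.
- by move=> g h; exact: linear_growthM.
- by move=> g; exact: linear_growthV.
- exact: linear_growth_sq.
- exact: linear_growth_sq.
Qed.

End heisenberg_tiling.

Local Open Scope ring_scope.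

(** * The action by change of leading digits *)

Section digits.
Variable R : realType.
Implicit Types (x y : R) (n i j : nat).

Definition leading_digits n x : nat := Num.truncn (16 ^+ n * x).

(** Equal fractional parts of [16 ^+ n * x] and [16 ^+ n * y] say that the base-16 expansions agree
    after the first [n] places, without infinite digit sequences. *)
Definition same_tail n x y : Prop :=
  [/\ `[0, 1[%classic x, `[0, 1[%classic y &
      16 ^+ n * x - (leading_digits n x)%:R =
      16 ^+ n * y - (leading_digits n y)%:R].

Let exp16_gt0 n : 0 < 16 ^+ n :> R. Proof. exact: exprn_gt0. Qed.

Lemma leading_digits_itv n x : 0 <= x ->
  (leading_digits n x)%:R <= 16 ^+ n * x < (leading_digits n x)%:R + 1.
Proof.
by move=> x0; rewrite natr1; apply: truncn_itv; rewrite mulr_ge0// ltW.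
Qed.

Lemma leading_digits_lt n x :
  `[0, 1[%classic x -> (leading_digits n x < 16 ^ n)%N.
Proof.
rewrite /= in_itv /= => /andP[x0 x1].
have /andP[+ _] := leading_digits_itv n x0.
rewrite -(ltr_nat R) natrX => /le_lt_trans; apply.
by rewrite -[ltRHS]mulr1 ltr_pM2l.
Qed.

Lemma same_tail_sym n x y : same_tail n x y -> same_tail n y x.
Proof. by case. Qed.

Lemma same_tail_trans n x y z :
  same_tail n x y -> same_tail n y z -> same_tail n x z.
Proof. by move=> [Ix _ xy] [_ Iz yz]; split=> //; rewrite xy. Qed.

Lemma same_tail_leading_digits n x y :
  same_tail n x y -> leading_digits n x = leading_digits n y -> x = y.
Proof.
move=> [_ _ xy] E; move: xy; rewrite E => /addIr/mulfI; apply.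
by rewrite gt_eqF.
Qed.

Let leading_digitsS n x : 0 <= x -> leading_digits n.+1 x =
  (leading_digits n x * 16 +
   Num.truncn (16 * (16 ^+ n * x - (leading_digits n x)%:R)))%N.
Proof.
move=> x0; have /andP[h1 h2] := leading_digits_itv n x0.
have u0 : 0 <= 16 * (16 ^+ n * x - (leading_digits n x)%:R) :> R by lra.
apply: truncn_def; have /andP[] := truncn_itv u0.
by rewrite exprS -addnS !natrD natrM => ? ?; apply/andP; split; lra.
Qed.

(** The next digit is the integer part of 16 times the common fractional part. *)
Lemma same_tailS n x y : same_tail n x y ->
  same_tail n.+1 x y /\ exists d, [/\ (d < 16)%N,
    leading_digits n.+1 x = (leading_digits n x * 16 + d)%N &
    leading_digits n.+1 y = (leading_digits n y * 16 + d)%N].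
Proof.
move=> [Ix Iy xy]; have [x0 y0] : 0 <= x /\ 0 <= y.
  by move: Ix Iy; rewrite /= !in_itv /= => /andP[-> _] /andP[-> _].
have := leading_digitsS n x0; have := leading_digitsS n y0; rewrite -xy.
set d := Num.truncn _ => yd xd; split; last first.
  exists d; split=> //; rewrite /d truncn_lt_nat; last first.
    by have /andP[] := leading_digits_itv n x0; lra.
  by have /andP[_] := leading_digits_itv n x0; lra.
by split=> //; rewrite xd yd !natrD !natrM exprS; lra.
Qed.

Lemma exists_leading_digits n x j : `[0, 1[%classic x -> (j < 16 ^ n)%N ->
  let y := x + (j%:R - (leading_digits n x)%:R) / 16 ^+ n in
  same_tail n x y /\ leading_digits n y = j.
Proof.
move=> Ix jn y.
have E : 16 ^+ n * y = 16 ^+ n * x + j%:R - (leading_digits n x)%:R.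
  by rewrite /y mulrDr mulrC [_ * (_ / _)]mulrC divfK ?gt_eqF// mulrC addrA.
have x0 : 0 <= x by move: Ix; rewrite /= in_itv => /andP[].
have /andP[h1 h2] := leading_digits_itv n x0.
have py : leading_digits n y = j.
  by apply: truncn_def; rewrite E -(natr1 j); apply/andP; split; lra.
split => //; split=> //; last by rewrite E py; lra.
rewrite /= in_itv /=; apply/andP; split.
  by rewrite -(pmulr_rge0 _ (exp16_gt0 n)) E; have := ler0n R j; lra.
rewrite -(ltr_pM2l (exp16_gt0 n)) E mulr1.
by move: jn; rewrite -(ler_nat R) natrX -natr1; lra.
Qed.

End digits.

(** * The cocycle of the tail relation *)

Section moves.
Variables (R : realType) (G : groupType) (c : nat -> nat -> G).
Hypothesis ct : tiling c.
Implicit Types (x y z : R) (g h : G) (n : nat).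

(** [g] is the cocycle value from [x] to [y], read on [n] digits. It is kept as a relation because a
    given [x] need not have a [y] for every [g]. *)
Definition moves_at n g x y : Prop :=
  same_tail n x y /\
  c n (leading_digits n y) = (g * c n (leading_digits n x))%g.

Definition moves g x y : Prop := exists n, moves_at n g x y.

Let moves_at_le m n g x y : (m <= n)%N -> moves_at m g x y -> moves_at n g x y.
Proof.
move=> /subnK <-; elim: (n - m)%N => // k IHk /IHk[xy E]; rewrite addSn.
have [xyS [d [d16 xd yd]]] := same_tailS xy; split => //.
(* The next digit is common to [x] and [y], so reading it leaves the quotient unchanged. *)
have := tiling_cocycle ct (k + m)%N
  (leading_digits (k + m) y) (leading_digits (k + m) x) d16.
by rewrite -xd -yd E mulgK => <-; rewrite mulgVK.
Qed.

Let moves2 g h x y u v : moves g x y -> moves h u v ->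
  exists n, moves_at n g x y /\ moves_at n h u v.
Proof.
move=> [m gm] [n hn]; exists (maxn m n); split.
  by apply: moves_at_le gm; exact: leq_maxl.
by apply: moves_at_le hn; exact: leq_maxr.
Qed.

Lemma moves1 x : `[0, 1[%classic x -> moves 1%g x x.
Proof. by move=> Ix; exists 0%N; split; rewrite ?mul1g. Qed.

Lemma movesM g h x y z : moves h x y -> moves g y z -> moves (g * h)%g x z.
Proof.
move=> hxy gyz; have [n [[xy hn] [yz gn]]] := moves2 hxy gyz.
exists n; split; first exact: same_tail_trans yz.
by rewrite gn hn mulgA.
Qed.

Lemma movesV g x y : moves g x y -> moves g^-1%g y x.
Proof.
by move=> [n [xy gn]]; exists n; split; [exact: same_tail_sym|rewrite gn mulKg].
Qed.

Lemma moves_fun g x y z : moves g x y -> moves g x z -> y = z.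
Proof.
move=> xy xz; have [n [[ty gy] [tz gz]]] := moves2 xy xz.
have yz := same_tail_trans (same_tail_sym ty) tz.
apply: (same_tail_leading_digits yz); apply: (tiling_inj ct (n := n)).
- by rewrite inE; apply: leading_digits_lt; case: ty.
- by rewrite inE; apply: leading_digits_lt; case: tz.
- by rewrite gy gz.
Qed.

Lemma moves_free g x : moves g x x -> g = 1%g.
Proof. by move=> [n [_ /esym/(canRL (mulgK _))]]; rewrite mulgV. Qed.

Lemma same_tail_moves n x y : same_tail n x y ->
  moves (c n (leading_digits n y) / c n (leading_digits n x))%g x y.
Proof. by move=> xy; exists n; split=> //; rewrite mulgVK. Qed.

Lemma moves_exists n g x : `[0, 1[%classic x ->
  (g * c n (leading_digits n x))%g \in tile c n ->
  exists2 y, same_tail n x y & moves g x y.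
Proof.
move=> Ix /tileP[j jn E]; have [xy yj] := exists_leading_digits Ix jn.
by eexists; [exact: xy|exists n; split=> //; rewrite yj].
Qed.

Lemma moves_tile n g x y : moves_at n g x y ->
  (g * c n (leading_digits n x))%g \in tile c n.
Proof.
move=> [[_ Iy _] <-]; apply/tileP; exists (leading_digits n y) => //.
exact: leading_digits_lt.
Qed.

Definition movable : set R :=
  [set x | `[0, 1[%classic x /\ forall g, exists y, moves g x y].

(** If [h] takes [x] to [y], moving [y] by [g] amounts to moving [x] by [g * h]. *)
Lemma movable_same_tail n x y : same_tail n x y -> movable x -> movable y.
Proof.
move=> xy [_ mx]; split=> [|g]; first by case: xy.
pose h := (c n (leading_digits n y) / c n (leading_digits n x))%g.
have [z hz] := mx (g * h)%g; exists z; rewrite -[g](mulgK h).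
exact: movesM (movesV (same_tail_moves xy)) hz.
Qed.

End moves.

Definition same_tail_closed (R : realType) (B : set R) : Prop :=
  forall n x y, same_tail n x y -> B x -> B y.

Section action.
Variables (R : realType) (G : groupType) (c : nat -> nat -> G) (B : set R).
Hypotheses (ct : tiling c) (Bc : B `<=` movable c) (Bt : same_tail_closed B).
Implicit Types (x y z : R) (g h : G) (n : nat).

(** The default value makes every group element fix the points outside [B]. With one [B] for both
    groups, the orbits agree there too. *)
Definition act g x : R := xget x [set y | B x /\ moves c g x y].

Lemma act_moves g x : B x -> moves c g x (act g x).
Proof.
move=> Bx; have [_ /(_ g)[y xy]] := Bc Bx; rewrite /act.
by case: xgetP => [z _ []//|/(_ y)/= []].
Qed.

Lemma act_out g x : ~ B x -> act g x = x.
Proof. by move=> Bx; rewrite /act xgetPN// => y []. Qed.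

Lemma act_eq g x y : B x -> moves c g x y -> act g x = y.
Proof. by move=> /act_moves/moves_fun; apply. Qed.

Let moves_B g x y : moves c g x y -> B x -> B y.
Proof. by move=> [n [xy _]]; exact: Bt xy. Qed.

Lemma act_action : is_group_action act.
Proof.
split=> [x|g h x]; have [Bx|Bx] := pselect (B x); rewrite ?(act_out _ Bx)//.
  by apply: act_eq => //; apply: moves1; case: (Bc Bx).
have hx := act_moves h Bx; apply: act_eq => //.
by apply: (movesM ct hx); apply: act_moves; exact: moves_B hx Bx.
Qed.

Lemma act_free g x : B x -> act g x = x -> g = 1%g.
Proof. by move=> /(act_moves g)/[swap] ->; exact: moves_free. Qed.

Lemma act_orbitE x : B x ->
  act_orbit act x = [set y | exists n, same_tail n x y].
Proof.
move=> Bx; apply/seteqP; split=> [_ [g _ <-]|y [n xy]] /=.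
  by have [n [xy _]] := act_moves g Bx; exists n.
by eexists => //; apply: act_eq => //; exact: same_tail_moves xy.
Qed.

Lemma act_orbit_out x : ~ B x -> act_orbit act x = [set x].
Proof.
move=> Bx; apply/seteqP; split=> [_ [g _ <-]|_ ->]; first exact: act_out.
by exists 1%g => //; exact: act_out.
Qed.

End action.

(** * Bijections that are piecewise translations preserve Lebesgue measure *)

Section lebesgue.
Variable R : realType.
Local Notation leb := (@lebesgue_measure R).

Lemma measurable_fun_addr (q : R) :
  measurable_fun [set: R] (fun x : R => x + q).
Proof. exact: measurable_funD. Qed.

Lemma lebesgue_measure_shift (q : R) (A : set R) : measurable A ->
  leb ((fun x => x + q) @^-1` A) = leb A.
Proof.
move=> mA.
suff : leb A = pushforward leb (fun x : R => x + q : measurableTypeR R) A by [].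
apply: lebesgue_measure_unique => //=; first exact: measurable_fun_addr.
move=> _ _ [[a b]] _ <-; rewrite /pushforward.
have -> : (fun x => x + q) @^-1` `]a, b] = `]a - q, b - q]%classic.
  by apply/seteqP; split=> x /=; rewrite !in_itv /= ltrBlDr lerBrDr.
by rewrite !lebesgue_measure_itv /= !lte_fin ltrD2r -!EFinB opprB addrA subrK.
Qed.

Variables (T : R -> R) (D : nat -> set R) (q : nat -> R).
Hypotheses (mD : forall i, measurable (D i)) (Dcover : \bigcup_i D i = setT).
Hypothesis TD : forall i x, D i x -> T x = x + q i.

(** The sets [D i] may overlap; [seqDU] makes them disjoint, so that measures add up. *)
Let E (A : set R) i := seqDU D i `&` (fun x => x + q i) @^-1` A.

Let mseqDU i : measurable (seqDU D i).
Proof. by apply: measurableD => //; exact: bigsetU_measurable. Qed.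

Let mE A i : measurable A -> measurable (E A i).
Proof.
move=> mA; apply: measurableI => //; rewrite -[X in measurable X]setTI.
exact: measurable_fun_addr.
Qed.

Let preimageE A : T @^-1` A = \bigcup_i E A i.
Proof.
apply/seteqP; split=> [x /= ATx|x [i _ [[Dx _] /=]]]; last by rewrite -(TD Dx).
have : (\bigcup_i D i) x by rewrite Dcover.
rewrite seqDU_bigcup_eq => -[i _ Dx]; exists i => //; split=> //=.
by rewrite -(TD (proj1 Dx)).
Qed.

Lemma measurable_piecewise_translation : measurable_fun [set: R] T.
Proof.
move=> _ A mA; rewrite setTI preimageE; apply: bigcupT_measurable => i.
exact: mE.
Qed.

Lemma lebesgue_piecewise_translation (A : set R) : bijective T ->
  measurable A -> leb (T @^-1` A) = leb A.
Proof.
move=> [S TK SK] mA; pose F i := (fun x => x - q i) @^-1` E A i.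
(* [F i] is [E A i] translated by [q i], that is, the part of [A] in the image of the i-th piece. As
   [T] is bijective, these parts partition [A]. *)
have FE i x : F i x <-> A x /\ seqDU D i (S x).
  rewrite /F /E /= subrK; split=> [[Dx Ax]|[Ax Dx]].
    by split=> //; rewrite -[x](subrK (q i)) -(TD (proj1 Dx)) TK.
  have <- : S x = x - q i.
    by apply/esym/(canLR (addrK _)); rewrite -(TD (proj1 Dx)) SK.
  by [].
have AF : A = \bigcup_i F i.
  apply/seteqP; split=> [x Ax|x [i _ /FE[]//]].
  have : (\bigcup_i D i) (S x) by rewrite Dcover.
  by rewrite seqDU_bigcup_eq => -[i _ Dx]; exists i => //; apply/FE.
have mF i : measurable (F i).
  rewrite -[X in measurable X]setTI; apply: measurable_fun_addr => //.
  exact: mE.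
rewrite preimageE [in RHS]AF !measure_bigcup//; last 4 first.
- by move=> i _; exact: mF.
- move=> i j _ _ [x [/FE[_ Di] /FE[_ Dj]]].
  by apply: (@trivIset_seqDU _ D) => //; exists (S x).
- by move=> i _; exact: mE.
- move=> i j _ _ [x [[Di _] [Dj _]]].
  by apply: (@trivIset_seqDU _ D) => //; exists x.
apply: eq_eseriesr => i _; rewrite /F.
by rewrite [RHS](lebesgue_measure_shift (- q i))//; exact: mE.
Qed.

End lebesgue.

(** The space is the whole real line, with a null set outside [[0, 1[]; its topology then shows
    directly that it is standard Borel. *)
Definition unit_interval_measure (R : realType) :=
  mrestr (@lebesgue_measure R) (measurable_itv `[0, 1[).

HB.instance Definition _ (R : realType) :=
  Measure.on (@unit_interval_measure R).

Lemma unit_interval_measureT (R : realType) :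
  unit_interval_measure [set: R] = 1%E.
Proof.
rewrite /unit_interval_measure /mrestr setTI.
rewrite lebesgue_measure_itv /= lte_fin ltr01.
by rewrite -EFinB subr0.
Qed.

HB.instance Definition _ (R : realType) :=
  Measure_isProbability.Build _ _ _ (@unit_interval_measure R)
    (unit_interval_measureT R).

Lemma standard_borel_measurableTypeR (R : realType) :
  standard_borel R (measurableTypeR R).
Proof.
exists R, id; split.
- exact: norm_hausdorff.
- pose F (q : rat * rat) : set R := `]ratr q.1, ratr q.2[%classic.
  exists (range F).
    exact: card_le_trans (card_image_le _ _) (countableP _).
  split=> [_ [q _ <-]|x A]; first exact: interval_open.
  rewrite nbhs_simpl => /nbhs_ballP[e e0 xeA].
  have e0' : 0 < e := e0.
  have /rat_in_itvoo[a] : x - e < x by rewrite ltrBlDr ltrDl.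
  have /rat_in_itvoo[b] : x < x + e by rewrite ltrDl.
  rewrite !in_itv /= => /andP[xb be] /andP[ea ax].
  exists (F (a, b)); first by split; [exists (a, b)|rewrite /F /= in_itv /= ax].
  move=> y; rewrite /F /= in_itv /= => /andP[ay yb]; apply: xeA.
  by rewrite ball_itv /= in_itv /= (lt_trans ea)//= (lt_trans yb).
- by exists id.
- move=> A; rewrite image_id; split.
    rewrite RGenOpens.measurableE.
    by apply: sub_smallest2r; [|move=> _ [x [y ->]]; exact: interval_open].
  move: A; apply: smallest_sub; first exact: sigma_algebra_measurable.
  exact: open_measurable.
Qed.

Section leading_sets.
Variable R : realType.
Local Notation mu := (@unit_interval_measure R).

Definition leading_set n (P : pred nat) : set R :=
  [set x | `[0, 1[%classic x /\ P (leading_digits n x)].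

Let cell n i : set R := `[i%:R / 16 ^+ n, i.+1%:R / 16 ^+ n[%classic.

Let exp16_gt0 n : 0 < 16 ^+ n :> R. Proof. exact: exprn_gt0. Qed.

Let leading_setE n P :
  leading_set n P =
  \big[setU/set0]_(i < 16 ^ n) (if P i then cell n i else set0).
Proof.
have cellE i x : cell n i x <-> i%:R <= 16 ^+ n * x < i.+1%:R.
  rewrite /cell /= in_itv /= ler_pdivrMr// ltr_pdivlMr//.
  by rewrite ![x * _]mulrC.
rewrite -(bigcup_mkord (16 ^ n) (fun i => if P i then cell n i else set0)).
apply/seteqP; split=> x.
  move=> [Ix Px]; exists (leading_digits n x) => /=.
    exact: leading_digits_lt.
  rewrite Px; apply/cellE; apply: truncn_itv; rewrite mulr_ge0// ?exprn_ge0//.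
  by move: Ix; rewrite /= in_itv => /andP[].
move=> [i /= i16]; case: ifP => // Pi /cellE ix.
split; last by rewrite /leading_digits (truncn_def ix).
rewrite /= in_itv /=; case/andP: ix => ix xi; apply/andP; split.
  by rewrite -(pmulr_rge0 _ (exp16_gt0 n)) (le_trans _ ix).
rewrite -(ltr_pM2l (exp16_gt0 n)) mulr1 (lt_le_trans xi)//.
by rewrite -natrX ler_nat.
Qed.

Let measurable_cell n (P : pred nat) i :
  measurable (if P i then cell n i else set0).
Proof. by case: ifP => // _; exact: measurable_itv. Qed.

Lemma measurable_leading_set n P : measurable (leading_set n P).
Proof.
by rewrite leading_setE; apply: bigsetU_measurable => i _; exact: measurable_cell.
Qed.

Lemma leading_set_measure n P :
  (mu (leading_set n P) <= ((count P (iota 0 (16 ^ n)))%:R / 16 ^+ n)%:E)%E.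
Proof.
apply: (@le_trans _ _ (lebesgue_measure (leading_set n P))).
  rewrite /mu /mrestr le_measure// ?inE; last exact: measurable_leading_set.
  by apply: measurableI => //; exact: measurable_leading_set.
rewrite leading_setE; apply: le_trans.
  apply: (@Boole_inequality _ _ _ (@lebesgue_measure R)
    (fun i => if P i then cell n i else set0)) => i _; exact: measurable_cell.
rewrite -sum1_count natr_sum mulr_suml -sumEFin [leRHS]big_mkcond /=.
rewrite -[X in iota 0 X]subn0 -/(index_iota 0 _) big_mkord lee_sum// => i _.
case: ifP => _; last by rewrite measure0.
rewrite lebesgue_measure_itv /= lte_fin ltr_pM2r ?invr_gt0// ltr_nat leqnn.
by rewrite -EFinB -mulrBl -natr1 addrC addKr.
Qed.

End leading_sets.

(** * Points that a group element cannot move within n digits *)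

Section escapes.
Variables (R : realType) (G : groupType) (c : nat -> nat -> G).
Hypothesis ct : tiling c.
Local Notation mu := (@unit_interval_measure R).

Definition escapes n (g : G) : set R :=
  leading_set n (fun i => (g * c n i)%g \notin tile c n).

Lemma measurable_escapes n g : measurable (escapes n g).
Proof. exact: measurable_leading_set. Qed.

Lemma escapes_measure g :
  exists C : nat, forall n, (mu (escapes n g) <= (C%:R / 2 ^+ n)%:E)%E.
Proof.
have [C gC] := tiling_exits ct g; exists C => n.
apply: le_trans (leading_set_measure _ _ _) _.
rewrite lee_fin ler_pdivrMr ?exprn_gt0//.
rewrite (_ : 16 = 2 * 8)%R; last by rewrite -natrM.
rewrite exprMn mulrA divfK ?expf_neq0// -natrX -natrM ler_nat.
by apply: leq_trans (gC n); rewrite /exits count_map.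
Qed.

Lemma escapes_negligible g : mu.-negligible (\bigcap_n escapes n g).
Proof.
have mE : measurable (\bigcap_n escapes n g).
  by apply: bigcapT_measurable => n; exact: measurable_escapes.
exists (\bigcap_n escapes n g); split => //.
(* The intersection has measure at most [C / 2 ^ n] for each n. With [n] the integer part of
   [C / e], C / e < n + 1 <= 2 ^ (n + 1), so the index [n.+1] gives at most [e]. *)
apply/eqP; rewrite eq_le measure_ge0 andbT; apply/lee_addgt0Pr => e e0.
rewrite add0e; have [C gC] := escapes_measure g.
pose n := Num.truncn (C%:R / e).
apply: (@le_trans _ _ (mu (escapes n.+1 g))).
  apply: le_measure; rewrite ?inE//; first exact: measurable_escapes.
  exact: bigcap_inf.
apply: le_trans (gC _) _; rewrite lee_fin ler_pdivrMr ?exprn_gt0//.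
rewrite mulrC -ler_pdivrMr//.
have := truncnS_gt (C%:R / e); rewrite -/n => /ltW/le_trans; apply.
by rewrite -natrX ler_nat ltnW// ltn_expl.
Qed.

Lemma movableE : @movable R G c =
  `[0, 1[%classic `\` \bigcup_g \bigcap_n escapes n g.
Proof.
apply/seteqP; split=> x [Ix mx]; split=> //.
  move=> [g _ gx]; have [y [n gxy]] := mx g.
  by have [_ /negP] := gx n I; apply; exact: moves_tile gxy.
move=> g; have [n gn] : exists n, ~ escapes n g x.
  apply/not_existsP => gx; apply: mx; exists g => // n _.
  exact: contrapT.
have [|y _ gxy] := @moves_exists R G c n g x Ix; last by exists y.
by apply: contrapT => /negP gx; apply: gn.
Qed.

Variable e : nat -> G.
Hypothesis e_surj : forall g, exists i, e i = g.

Let bigcup_enum (F : G -> set R) : \bigcup_g F g = \bigcup_i F (e i).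
Proof.
apply/seteqP; split=> x [i _ Fx]; last by exists (e i).
by have [j ji] := e_surj i; exists j; rewrite ?ji.
Qed.

Lemma measurable_movable : measurable (@movable R G c).
Proof.
rewrite movableE bigcup_enum; apply: measurableD => //.
apply: bigcupT_measurable => i; apply: bigcapT_measurable => n.
exact: measurable_escapes.
Qed.

Lemma movable_negligible : mu.-negligible (~` @movable R G c).
Proof.
rewrite movableE setCD bigcup_enum; apply: negligibleU.
  exists (~` `[0, 1[%classic); split=> //; first exact: measurableC.
  by rewrite /= /unit_interval_measure /mrestr setICl measure0.
by apply: negligible_bigcup => i; exact: escapes_negligible.
Qed.

End escapes.

(** * The action is free and measure preserving *)

Section act_measure.
Variables (R : realType) (G : groupType) (c : nat -> nat -> G) (B : set R).
Hypotheses (ct : tiling c) (Bc : B `<=` movable c) (Bt : same_tail_closed B).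
Hypotheses (mB : measurable B).
Hypotheses (Bneg : (@unit_interval_measure R).-negligible (~` B)).
Local Notation mu := (@unit_interval_measure R).

(** Index 0 is the complement of [B], where nothing moves. A successor codes a triple (n, i, j) such
    that [g] replaces the prefix [i] of length [n] by [j], which is the translation by [q]. *)
Let D (g : G) (m : nat) : set R :=
  if m is m'.+1 then
    if unpickle m' is Some (n, i, j) then
      if (c n j == g * c n i)%g && (j < 16 ^ n)%N
      then B `&` leading_set n (pred1 i) else set0
    else set0
  else ~` B.

Let q (m : nat) : R :=
  if m is m'.+1 then
    if unpickle m' is Some (n, i, j) then (j%:R - i%:R) / 16 ^+ n else 0
  else 0.

Let mD g m : measurable (D g m).
Proof.
case: m => [|m] /=; first exact: measurableC.
case: (unpickle m) => [[[n i] j]|//]; case: ifP => // _.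
by apply: measurableI => //; exact: measurable_leading_set.
Qed.

Let Dcover g : \bigcup_m D g m = setT.
Proof.
apply/seteqP; split=> // x _; have [Bx|Bx] := pselect (B x); last by exists 0%N.
have [n [xy gn]] := act_moves Bc g Bx.
exists (pickle (n, leading_digits n x,
  leading_digits n (act c B g x))).+1 => //=.
rewrite pickleK gn eqxx leading_digits_lt/=; last by case: xy.
by split=> //; split; [case: xy|exact: eqxx].
Qed.

Let TD g m x : D g m x -> act c B g x = x + q m.
Proof.
case: m => [|m] /=; first by move=> Bx; rewrite addr0 act_out.
case: (unpickle m) => [[[n i] j]|//]; case: ifP => // /andP[/eqP cij j16].
move=> [Bx [Ix /eqP px]].
have := exists_leading_digits Ix j16; rewrite px => -[xy yj].
by apply: (act_eq ct Bc) => //; exists n; split=> //; rewrite yj px.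
Qed.

Let act_bij g : bijective (act c B g).
Proof.
have [a1 aM] := act_action ct Bc Bt.
by exists (act c B g^-1%g) => x; rewrite -aM ?mulVg ?mulgV a1.
Qed.

(** Invariance of the interval passes preservation from Lebesgue measure to its restriction. *)
Lemma act_unit g : act c B g @^-1` `[0, 1[%classic = `[0, 1[%classic.
Proof.
apply/seteqP; split=> x; rewrite /preimage /mkset;
  have [Bx|/(act_out c g) ->//] := pselect (B x);
  by have [n [[]]] := act_moves Bc g Bx.
Qed.

Lemma act_free_pmp : free_pmp_action mu (act c B).
Proof.
split.
- exact: act_action.
- move=> g; exact: (measurable_piecewise_translation (mD g) (Dcover g) (@TD g)).
- move=> g A mA; rewrite /= /unit_interval_measure /mrestr.
  rewrite -[in LHS](act_unit g) -preimage_setI.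
  apply: (lebesgue_piecewise_translation (mD g) (Dcover g) (@TD g)) => //.
  exact: measurableI.
- apply: negligibleS Bneg => x /=; apply: contra_not => Bx g.
  exact: (act_free Bc).
Qed.

End act_measure.

(** * Integrability *)

Section orbit_dist.
Variables (R : realType) (G : groupType) (S : set G) (X : Type).
Variable a : G -> X -> X.
Implicit Types (x y : X) (g : G).

Lemma orbit_dist_le x y g n :
  y = a g x -> length_le S g n -> (orbit_dist R S a x y <= n%:R%:E)%E.
Proof.
move=> yg [w [Sw wg wn]]; apply: ge_ereal_inf; exists (word_length R S g).
  by exists g.
apply: ge_ereal_inf; exists (size w)%:R%:E; first by exists w.
by rewrite lee_fin ler_nat.
Qed.

Lemma orbit_dist_ge0 x y : (0 <= orbit_dist R S a x y)%E.
Proof.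
apply: le_ereal_inf_tmp => _ [g _ <-]; apply: le_ereal_inf_tmp => _ [w _ <-].
by rewrite lee_fin.
Qed.

End orbit_dist.

(* The orbit distance is not shown to be measurable, so that [ge0_le_integral]
   does not apply to it. *)
Lemma ge0_le_integralT (d : measure_display) (T : measurableType d)
  (R : realType) (mu : {measure set T -> \bar R}) (f h : T -> \bar R) :
  (forall x, 0 <= f x)%E -> (forall x, f x <= h x)%E ->
  (\int[mu]_x f x <= \int[mu]_x h x)%E.
Proof.
move=> f0 fh; have h0 x : (0 <= h x)%E by exact: le_trans (fh x).
rewrite !ge0_integralTE//; apply: ge_ereal_sup => _ [k kf <-].
by apply: ereal_sup_ubound; exists k => // x; exact: le_trans (kf x) (fh x).
Qed.

Lemma geometric_nneseries_lty (R : realType) (a z : R) : 0 <= a -> 0 <= z < 1 ->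
  (\sum_(0 <= n <oo) (a * z ^+ n)%:E < +oo)%E.
Proof.
move=> a0 /andP[z0 z1].
apply: (@le_lt_trans _ _ (a / (1 - z))%:E); last exact: ltry.
have az0 n : 0 <= a * z ^+ n by rewrite mulr_ge0// exprn_ge0.
apply: lime_le; first by apply: is_cvg_nneseries => n _ _; rewrite lee_fin.
apply: nearW => n; rewrite sumEFin lee_fin.
have := geometric_seriesE a (negbT (lt_eqF z1)).
move=> /(congr1 (@^~ n)); rewrite /series /= => ->.
by rewrite ler_pM2r ?invr_gt0 ?subr_gt0// ler_piMr// gerBl exprn_ge0.
Qed.

Section integrability.
Variables (R : realType) (G H : groupType).
Variables (c : nat -> nat -> G) (c' : nat -> nat -> H) (B : set R).
Hypotheses (ct : tiling c) (ct' : tiling c').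
Hypotheses (Bc : B `<=` movable c) (Bc' : B `<=` movable c').
Local Notation mu := (@unit_interval_measure R).

(** The element taking [x] to [y] is a quotient of two elements of the n-th tile, each of length at
    most [C * 2 ^ n]. *)
Lemma orbit_dist_same_tail (S : set H) (C n : nat) (x y : R) :
  (forall s, S s -> S (s^-1)%g) ->
  (forall n i, length_le S (c' n i) (C * 2 ^ n)) ->
  B x -> same_tail n x y ->
  (orbit_dist R S (act c' B) x y <= ((C + C) * 2 ^ n)%:R%:E)%E.
Proof.
move=> Ssym Sc' Bx xy.
apply: (@orbit_dist_le _ _ _ _ _ _ _
  (c' n (leading_digits n y) / c' n (leading_digits n x))%g).
  by apply/esym/act_eq => //; exact: same_tail_moves.
by rewrite mulnDl; apply: length_leM => //; exact: length_leV.
Qed.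

Lemma act_orbit_dist_Lp (S : set H) (p : R) : finite_symmetric_generating S ->
  0 < p -> p < 1 -> orbit_dist_Lp mu S (act c B) (act c' B) p.
Proof.
move=> gS p0 p1 g; have [_ Ssym _] := gS.
have [C Sc'] := tiling_length ct' gS; have [E gE] := escapes_measure R ct g.
(* The index is shifted by one: if [n] digits suffice at [x] and [n = 0] or [n - 1] do not, then [x]
   is in [A n] and the p-th power of the distance is at most [K n]. The sum of the [h n] is
   therefore a majorant. *)
pose A n : set R := if n is n'.+1 then escapes c n' g else setT.
have mA n : measurable (A n) by case: n => [|n] //=; exact: measurable_escapes.
pose K n : R := ((C + C) * 2 ^ n)%:R `^ p.
have K0 n : 0 <= K n by exact: powR_ge0.
pose h (n : nat) (x : R) : \bar R := ((K n)%:E * (\1_(A n) x)%:E)%E.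
have h0 n x : (0 <= h n x)%E by rewrite mule_ge0// lee_fin.
have mh n : measurable_fun [set: measurableTypeR R] (h n).
  apply: measurable_funeM; apply/measurable_EFinP.
  by apply: measurable_indic; exact: mA.
apply: (@le_lt_trans _ _ (\int[mu]_x \sum_(0 <= n <oo) h n x)%E).
  apply: ge0_le_integralT => x; first exact: poweR_ge0.
  have hle n : A n x -> ((K n)%:E <= \sum_(0 <= n <oo) h n x)%E.
    move=> Ax; apply: (@le_trans _ _ (h n x)).
      by rewrite /h indicE mem_set// mule1.
    apply: le_trans (nneseries_lim_ge n.+1 _) => //.
    by rewrite big_nat_recr//= leeDr// sume_ge0.
  (* Outside [B] both actions fix [x], so the distance is 0, and so is its p-th power because p >
     0. *)
  have [Bx|Bx] := pselect (B x); last first.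
    rewrite (_ : orbit_dist _ _ _ _ _ = 0%E).
      by rewrite poweR0r ?gt_eqF// nneseries_ge0.
    apply/eqP; rewrite eq_le orbit_dist_ge0 andbT.
    apply: (@orbit_dist_le _ _ _ _ _ _ _ 1%g 0); last exact: length_le1.
    by rewrite !act_out.
  have [all_esc|/existsNP[n0 nesc]] := pselect (forall n, escapes c n g x).
    by have := Bc Bx; rewrite movableE// => -[_ []]; exists g.
  (* Descending from [n0] while the preceding stage also succeeds stops at such an [n], without
     monotonicity of the sets [escapes]. *)
  have [n nescn minn] : exists2 n, ~ escapes c n g x & A n x.
    elim: n0 nesc => [|n IHn] nesc; first by exists 0%N.
    by have [|/IHn//] := pselect (escapes c n g x); exists n.+1.
  apply: le_trans (hle n minn).
  have Ix : `[0, 1[%classic x by case: (Bc Bx).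
  have [|y xy gxy] := @moves_exists R G c n g x Ix.
    by apply: contrapT => /negP gx; apply: nescn.
  rewrite (act_eq ct Bc Bx gxy) -[(K n)%:E]poweR_EFin.
  apply: gt0_ler_poweR; first exact: ltW.
  - by rewrite in_itv /= orbit_dist_ge0 leey.
  - by rewrite in_itv /= lee_fin leey andbT.
  - exact: orbit_dist_same_tail.
rewrite integral_nneseries//.
(* The ratio [z] is below 1 exactly because p < 1. In [D], the 1 accounts for [A 0], of full
   measure, and the factor 2 for the shifted index, since [E / 2 ^ n] bounds the measure of
   [A n.+1]. *)
pose z : R := 2 `^ p / 2; pose D : R := ((C + C)%:R `^ p) * (1 + E%:R * 2).
have z0 : 0 <= z by rewrite divr_ge0// powR_ge0.
apply: le_lt_trans (@geometric_nneseries_lty R D z _ _); last first.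
- rewrite z0 ltr_pdivrMr// mul1r /powR gt_eqF// -[ltRHS]lnK ?posrE//.
  by rewrite ltr_expR gtr_pMl// ln_gt0 ?ltr1n//.
- by rewrite mulr_ge0 ?powR_ge0// addr_ge0// mulr_ge0.
apply: lee_nneseries => n _.
  by move=> _; apply: integral_ge0 => x _; exact: h0.
rewrite ge0_integralZl_EFin//; last first.
  by apply/measurable_EFinP; by apply: measurable_indic; exact: mA.
rewrite integral_indic; [|exact: measurableT|exact: mA].
rewrite (_ : A n `&` _ = A n); last exact: setIT.
have muA : (mu (A n) <= ((1 + E%:R * 2) / 2 ^+ n)%:E)%E.
  case: n => [|n] /=.
    by rewrite [mu _]probability_setT lee_fin expr0 divr1 lerDl mulr_ge0.
  apply: le_trans (gE n) _; rewrite lee_fin exprS invfM mulrA.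
  by rewrite ler_pM2r ?invr_gt0 ?exprn_gt0// ler_pdivlMr// lerDr.
have -> : K n = (C + C)%:R `^ p * (2 `^ p) ^+ n.
  rewrite /K natrM powRM// natrX; congr (_ * _).
  by rewrite -powR_mulrn// -powRrM mulrC powRrM powR_mulrn ?powR_ge0.
apply: le_trans (lee_wpmul2l _ muA) _.
  by rewrite lee_fin mulr_ge0// exprn_ge0// powR_ge0.
by rewrite -EFinM lee_fin /D /z exprMn exprVn mulrACA !mulrA.
Qed.

End integrability.

(** * The coupling of the two groups *)

Lemma countType_enum (T : countType) (x : T) :
  exists e : nat -> T, forall y, exists i, e i = y.
Proof.
exists (fun i => odflt x (unpickle i)) => y.
by exists (pickle y); rewrite pickleK.
Qed.

Theorem theorem7 (R : realType) :
  exists (d : measure_display) (X : measurableType d) (mu : probability X R)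
    (a : Z4 -> X -> X) (b : heisenberg -> X -> X),
    oe_coupling mu a b /\
    forall (SG : set Z4) (SH : set heisenberg),
      finite_symmetric_generating SG -> finite_symmetric_generating SH ->
      forall p : R, 0 < p -> p < 1 -> Lp_Lp_integrable mu SG SH a b p.
Proof.
have [c ct] := Z4_tiling; have [c' ct'] := heisenberg_tiling.
have [e eS] : exists e : nat -> Z4, forall g, exists i, e i = g.
  exact: (@countType_enum 'rV[int]_4 0).
have [e' eS'] : exists e : nat -> heisenberg, forall g, exists i, e i = g.
  exact: (@countType_enum (int * int * int)%type heis_one).
(* Both actions are cut down to the same conull set, a union of tail classes. Their orbits then
   coincide at every point: tail classes inside [B], singletons outside. *)
pose B : set R := movable c `&` movable c'.
have Bc : B `<=` movable c by exact: subIsetl.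
have Bc' : B `<=` movable c' by exact: subIsetr.
have Bt : same_tail_closed B.
  by move=> n x y xy [mx mx']; split; exact: movable_same_tail xy _.
have mB : measurable B.
  by apply: measurableI;
    [exact: measurable_movable eS|exact: measurable_movable eS'].
have Bneg : (@unit_interval_measure R).-negligible (~` B).
  rewrite /B setCI; apply: negligibleU; first exact: movable_negligible eS.
  exact: movable_negligible eS'.
exists _, (measurableTypeR R), (@unit_interval_measure R), (act c B), (act c' B).
split; last first.
  by move=> SG SH gSG gSH p p0 p1; split; exact: act_orbit_dist_Lp.
split.
- exact: standard_borel_measurableTypeR.
- exact: act_free_pmp.
- exact: act_free_pmp.
- apply: aeW => x.
  by have [Bx|Bx] := pselect (B x); [rewrite !act_orbitE|rewrite !act_orbit_out].
Qed.
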